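(* Let $q>1$ and let $\sigma$ be a nonnegative Radon measure on $M$. Suppose that for some metric $\tilde d$ on $M$ (not necessarily the geodesic distance) and some $\gamma>0$, $$G(x,y)\approx \tilde d(x,y)^{-\gamma},\quad x,y\in M.$$ Then the integral inequality $$u(x)\ge \int_M G(x,y)\,[u(y)]^q\,d\sigma(y),\quad x\in M,$$ has a positive solution if and only if there exist $o\in M$, $r_0>0$ and $C>0$ such that $$\int_{r_0}^{+\infty}\frac{\sigma(\tilde B(o,t))}{t^{\gamma q+1}}\,dt<\infty$$ and $$\sup_{x\in\tilde B(o,r)}\int_0^r\frac{\sigma(\tilde B(x,s))}{s^{\gamma+1}}\,ds\le C\,r^{\gamma(q-1)}\quad\text{for all } r>r_0.$$
   Context: $M$ is a connected complete non-compact Riemannian manifold with Laplace-Beltrami operator $\Delta$. $M$ is assumed non-parabolic, i.e. $\Delta$ has a positive finite Green function; $G(x,y)$ denotes the minimal (positive) Green function of $\Delta$ on $M$ (finite for $x\neq y$, $+\infty$ on the diagonal). $\tilde B(x,r)=\{y\in M:\tilde d(x,y)<r\}$ denotes the balls of the metric $\tilde d$. The sign $\approx$ means that the ratio of the left- and right-hand sides is bounded from above and below by two positive constants (independent of $x,y$). A solution of the integral inequality is a non-negative lower semicontinuous function $u:M\to[0,\infty)$ satisfying it for all $x\in M$; it is positive if $u>0$ on $M$. *)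

(* Defs.v *)
From HB Require Import structures.
From mathcomp Require Import all_boot all_order all_algebra.
From mathcomp Require Import all_classical all_reals all_analysis.

Set Implicit Arguments.
Unset Strict Implicit.
Unset Printing Implicit Defensive.

Import Order.TTheory GRing.Theory Num.Theory.
Import numFieldNormedType.Exports.

Local Open Scope classical_set_scope.
Local Open Scope ring_scope.

Notation borel T := (g_sigma_algebraType (@open T)).

Definition axis {R : realType} {n : nat} (k : 'I_n) : 'rV[R]_n := delta_mx 0 k.

Definition iter_partial {R : realType} {n : nat} (s : seq 'I_n)
    (f : 'rV[R]_n -> R) : 'rV[R]_n -> R :=
  foldr (fun k h => 'D_(axis k) h) f s.

                                                                        
                                                                        
Definition smooth_on {R : realType} {n : nat} (D : set 'rV[R]_n)
    (f : 'rV[R]_n -> R) : Prop :=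
  forall (s : seq 'I_n) (p : 'rV[R]_n), D p ->
    {for p, continuous (iter_partial s f)} /\
    forall k, derivable (iter_partial s f) p (axis k).

                                                                           
                                                                            
                                                                             
                                                                           
                                                                         
                                                                         
                                                                            
                                                                             
Record riemannian_manifold (R : realType) (n : nat) (M : ptopologicalType) := {
  chart : Type;
  dom : chart -> set M;
  coord : chart -> M -> 'rV[R]_n;
  param : chart -> 'rV[R]_n -> M;
  chart_at : M -> chart;
  metric : chart -> 'rV[R]_n -> 'M[R]_n;
  manifold_hausdorff : hausdorff_space M;
  manifold_second_countable : @second_countable M;
  dom_open : forall i, open (dom i);
  image_open : forall i, open (coord i @` dom i);
  coordK : forall i x, dom i x -> param i (coord i x) = x;
  coord_continuous : forall i x, dom i x -> {for x, continuous (coord i)};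
  param_continuous : forall i p, (coord i @` dom i) p ->
    {for p, continuous (param i)};
  chart_atP : forall x, dom (chart_at x) x;
  transition_smooth : forall i j k,
    smooth_on (coord i @` (dom i `&` dom j))
              (fun p => coord j (param i p) 0 k);
  metric_smooth : forall i k l,
    smooth_on (coord i @` dom i) (fun p => metric i p k l);
  metric_sym : forall i p, (coord i @` dom i) p ->
    (metric i p)^T = metric i p;
  metric_posdef : forall i p, (coord i @` dom i) p ->
    forall v : 'rV[R]_n, v != 0 -> 0 < (v *m metric i p *m v^T) 0 0;
  metric_compat : forall i j x, dom i x -> dom j x ->
    let J := 'J (coord j \o param i) (coord i x) in
    metric i (coord i x) = J *m metric j (coord j x) *m J^T }.

Arguments dom {R n M} r i _.
Arguments coord {R n M} r i _.
Arguments param {R n M} r i _.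
Arguments metric {R n M} r i _.

                                                                          
                                                                 
Definition C1_curve {R : realType} {n : nat} {M : ptopologicalType}
    (S : riemannian_manifold R n M) (a b : R) (c : R -> M) : Prop :=
  forall t, a <= t <= b ->
    {for t, continuous c} /\
    forall i, dom S i (c t) ->
      (\forall s \near t, derivable (coord S i \o c) s 1) /\
      {for t, continuous (derive1 (coord S i \o c))}.

Definition speed {R : realType} {n : nat} {M : ptopologicalType}
    (S : riemannian_manifold R n M) (c : R -> M) (t : R) : R :=
  let i := chart_at S (c t) in
  let v := derive1 (coord S i \o c) t in
  Num.sqrt ((v *m metric S i (coord S i (c t)) *m v^T) 0 0).

                                                                           
Inductive joined_by {R : realType} {n : nat} {M : ptopologicalType}
    (S : riemannian_manifold R n M) : M -> M -> R -> Prop :=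
| joined_C1 : forall (a b : R) (c : R -> M), a <= b -> C1_curve S a b c ->
    joined_by S (c a) (c b)
      (\int[@lebesgue_measure R]_(t in `[a, b]) speed S c t)
| joined_cat : forall (x y z : M) (L1 L2 : R),
    joined_by S x y L1 -> joined_by S y z L2 -> joined_by S x z (L1 + L2).

Definition geodesic_dist {R : realType} {n : nat} {M : ptopologicalType}
    (S : riemannian_manifold R n M) (x y : M) : R :=
  inf [set L | joined_by S x y L].

Definition complete_manifold {R : realType} {n : nat} {M : ptopologicalType}
    (S : riemannian_manifold R n M) : Prop :=
  forall x_ : nat -> M,
    (forall e : R, 0 < e -> exists N : nat, forall j k : nat,
      (N <= j)%N -> (N <= k)%N -> geodesic_dist S (x_ j) (x_ k) < e) ->
    exists x : M, x_ @ \oo --> x.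

                                                                       
                                     
Definition is_lebesgue {R : realType} {n : nat}
    (lambda : {measure set (borel 'rV[R]_n) -> \bar R}) : Prop :=
  forall a b : 'rV[R]_n, (forall k, a 0 k <= b 0 k) ->
    lambda [set p | forall k, a 0 k <= p 0 k <= b 0 k] =
    (\prod_(k < n) (b 0 k - a 0 k))%:E.

Definition vol_density {R : realType} {n : nat} {M : ptopologicalType}
    (S : riemannian_manifold R n M) (i : chart S) (p : 'rV[R]_n) : R :=
  Num.sqrt (\det (metric S i p)).

Arguments vol_density {R n M} S i p.

Definition is_riemannian_measure {R : realType} {n : nat}
    {M : ptopologicalType} (S : riemannian_manifold R n M)
    (mu : {measure set (borel M) -> \bar R}) : Prop :=
  exists2 lambda : {measure set (borel 'rV[R]_n) -> \bar R},
    is_lebesgue lambda &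
    forall i (A : set (borel M)), measurable A -> A `<=` dom S i ->
      mu A = (\int[lambda]_(p in coord S i @` A) (vol_density S i p)%:E)%E.

Definition smooth_fun {R : realType} {n : nat} {M : ptopologicalType}
    (S : riemannian_manifold R n M) (D : set M) (f : M -> R) : Prop :=
  forall i, smooth_on (coord S i @` (dom S i `&` D)) (f \o param S i).

Definition test_fun {R : realType} {n : nat} {M : ptopologicalType}
    (S : riemannian_manifold R n M) (f : M -> R) : Prop :=
  smooth_fun S setT f /\ compact (closure [set x | f x != 0]).

                                                                 
Definition laplacian {R : realType} {n : nat} {M : ptopologicalType}
    (S : riemannian_manifold R n M) (f : M -> R) (x : M) : R :=
  let i := chart_at S x in
  let flux k p := vol_density S i p *
    \sum_(l < n) invmx (metric S i p) k l * 'D_(axis l) (f \o param S i) p in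
  (vol_density S i (coord S i x))^-1 *
    \sum_(k < n) 'D_(axis k) (flux k) (coord S i x).

                                                                      
                                                                       
                                                                       
                                                                           
Record is_green_at {R : realType} {n : nat} {M : ptopologicalType}
    (S : riemannian_manifold R n M) (mu : {measure set (borel M) -> \bar R})
    (x : M) (g : M -> \bar R) : Prop := {
  green_gt0 : forall y, (0 < g y)%E;
  green_pole : g x = +oo%E;
  green_fin : forall y, y <> x -> (g y < +oo)%E;
  green_cvg_pole : {for x, continuous g};
  green_smooth : smooth_fun S (~` [set x]) (fine \o g);
  green_locally_integrable : forall K : set (borel M),
    compact (K : set M) -> mu.-integrable K g;
  green_fundamental : forall f : M -> R, test_fun S f ->
    (\int[mu]_y (g y * (laplacian S f y)%:E) = (- f x)%:E)%E }.

Definition nonparabolic {R : realType} {n : nat} {M : ptopologicalType}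
    (S : riemannian_manifold R n M)
    (mu : {measure set (borel M) -> \bar R}) : Prop :=
  exists G : M -> M -> \bar R, forall x, is_green_at S mu x (G x).

Definition is_minimal_green {R : realType} {n : nat} {M : ptopologicalType}
    (S : riemannian_manifold R n M) (mu : {measure set (borel M) -> \bar R})
    (G : M -> M -> \bar R) : Prop :=
  [/\ forall x, is_green_at S mu x (G x),
      forall x y, G x y = G y x &
      forall x h, is_green_at S mu x h -> forall y, (G x y <= h y)%E].

                                                                         
                                                              
Definition is_radon {R : realType} {M : ptopologicalType}
    (sigma : {measure set (borel M) -> \bar R}) : Prop :=
  forall K : set M, compact K -> (sigma K < +oo)%E.

Definition is_metric {R : realType} {M : Type} (d : M -> M -> R) : Prop :=
  [/\ forall x y, 0 <= d x y,
      forall x y, d x y = 0 <-> x = y,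
      forall x y, d x y = d y x &
      forall x y z, d x z <= d x y + d y z].

Definition metric_ball {R : realType} {M : Type} (d : M -> M -> R)
    (x : M) (r : R) : set M := [set y | d x y < r].

                                                                        
                                                                             
Definition comparable_to_power {R : realType} {M : Type}
    (G : M -> M -> \bar R) (d : M -> M -> R) (gamma : R) : Prop :=
  exists c1 c2 : R, [/\ 0 < c1, 0 < c2 &
    forall x y, x <> y ->
      ((c1 * d x y `^ (- gamma))%:E <= G x y)%E /\
      (G x y <= (c2 * d x y `^ (- gamma))%:E)%E].

Definition is_positive_solution {R : realType} {M : ptopologicalType}
    (G : M -> M -> \bar R) (q : R)
    (sigma : {measure set (borel M) -> \bar R}) (u : M -> R) : Prop :=
  [/\ forall x, 0 < u x,
      lower_semicontinuous (fun x => (u x)%:E) &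
      forall x,
        (\int[sigma]_y (G x y * (u y `^ q)%:E) <= (u x)%:E)%E].

(* Main.v *)
(* Write |y| := r0 + d o y. Since G blows up at its pole, the distances d x are
   continuous, and G x y is comparable to d x y ^ (- gamma), +oo on the diagonal
   included. By Tonelli's theorem the two conditions say that |y| ^ (- gamma q)
   is sigma-integrable and that the potential of the restriction of sigma to a
   ball of radius r at distance less than r from o is O(r ^ (gamma (q - 1))).

   These conditions suffice: e |x| ^ (- gamma) is a solution for e small, by
   splitting the integral over y at d x y = |x| / 2.

   Conversely, let u be a solution, w := u ^ q, and let a be a lower bound for
   the mass of w near o. Then u(y) is at least c |y| ^ (- gamma) (a + F(y)) with
   F(y) the integral of w over {z | d o z <= d o y}, so |y| ^ (- gamma q) is at
   most a constant times (a + F) ^ (- q) w. As F is the distribution function of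
   w along d o, the integral of (a + F) ^ (- q) w is O(a ^ (1 - q)) whatever w,
   as for the integral of (a + t) ^ (- q) dt over t > 0. The local condition at
   x follows in the same way from u(y) >= c (a r ^ (- gamma) + H(y)) for
   d x y < r, with H(y) the integral of d x z ^ (- gamma) w(z) over
   {z | d x z >= d x y}. *)

Require Import Defs.
From HB Require Import structures.
From mathcomp Require Import all_boot all_order all_algebra.
From mathcomp Require Import all_classical all_reals all_analysis.
From mathcomp Require Import measurable_realfun ring lra.

Set Implicit Arguments.
Unset Strict Implicit.
Unset Printing Implicit Defensive.

Import Order.TTheory GRing.Theory Num.Theory.
Import numFieldNormedType.Exports.

Local Open Scope classical_set_scope.
Local Open Scope ring_scope.

(** * Powers, and monotonicity of nonnegative integrals *)

Lemma ler_powRN (R : realType) (p x y : R) :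
  0 <= p -> 0 < x -> x <= y -> y `^ (- p) <= x `^ (- p).
Proof.
move=> p0 x0 xy; have y0 : 0 < y := lt_le_trans x0 xy.
rewrite !powRN lef_pV2 ?posrE ?powR_gt0//.
by apply: ge0_ler_powR => //; rewrite nnegrE ltW.
Qed.

Lemma powR_lt1_gt1 (R : realType) (q : R) : 1 < q -> 2 `^ (1 - q) < 1 :> R.
Proof.
move=> q1; have -> : 2 `^ (1 - q) = (2 `^ (q - 1))^-1 :> R.
  by rewrite -powRN opprB.
rewrite invf_lt1 ?powR_gt0//.
have : 1 `^ (q - 1) < 2 `^ (q - 1) :> R.
  by apply: gt0_ltr_powR; rewrite ?subr_gt0 ?nnegrE ?ltr1n.
by rewrite powR1.
Qed.

Lemma measurable_powRV (R : realType) (p : R) :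
  measurable_fun [set: R] (fun s : R => (s `^ p)^-1).
Proof.
have -> : (fun s : R => (s `^ p)^-1) = fun s => s `^ (- p).
  by apply/funext => s; rewrite powRN.
exact: measurable_powR.
Qed.

Section nonmeasurable.
Import HBNNSimple.

(** The integral of a nonnegative function is the supremum over the simple functions below it, and a
    larger integrand admits more of them. This serves for integrands whose measurability is not
    established, such as those containing [G x y] or an inner integral. *)
Lemma ge0_le_integral_nonmeasurable (d : measure_display)
    (T : measurableType d) (R : realType) (mu : {measure set T -> \bar R})
    (D : set T) (f g : T -> \bar R) :
  (forall x, D x -> (0 <= f x)%E) -> (forall x, D x -> (f x <= g x)%E) ->
  (\int[mu]_(x in D) f x <= \int[mu]_(x in D) g x)%E.
Proof.
move=> f0 fg.
have g0 x : D x -> (0 <= g x)%E.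
  by move=> Dx; exact: le_trans (f0 x Dx) (fg x Dx).
rewrite !ge0_integralE//.
apply: ge_ereal_sup => _ [h /= hf <-].
apply: le_ereal_sup_tmp; exists (sintegral mu h) => //; exists h => // x.
apply: le_trans (hf x) _; rewrite /patch; case: ifP => //.
by rewrite inE => Dx; exact: fg.
Qed.

Lemma ge0_subset_le_integral (d : measure_display)
    (T : measurableType d) (R : realType) (mu : {measure set T -> \bar R})
    (A B : set T) (f g : T -> \bar R) : A `<=` B ->
  (forall x, A x -> (0 <= f x)%E) -> (forall x, B x -> (0 <= g x)%E) ->
  (forall x, A x -> (f x <= g x)%E) ->
  (\int[mu]_(x in A) f x <= \int[mu]_(x in B) g x)%E.
Proof.
move=> AB f0 g0 fg; rewrite (integral_mkcond A) (integral_mkcond B).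
apply: ge0_le_integral_nonmeasurable => x _; rewrite /patch.
  by case: ifP => //; rewrite inE => /f0.
case: ifP => [|_].
  by rewrite inE => Ax; rewrite mem_set; [exact: fg|exact: AB].
by case: ifP => //; rewrite inE => /g0.
Qed.

End nonmeasurable.

(** * Integrals weighted by cumulative functions *)

Section sublevel.
Context (d : measure_display) (T : measurableType d) (R : realType)
  (mu : {measure set T -> \bar R}) (f : T -> \bar R) (g : T -> R).
Hypothesis mf : measurable_fun [set: T] f.
Hypothesis f0 : forall x, (0 <= f x)%E.
Hypothesis mg : measurable_fun [set: T] g.

Let H (y : T) := (\int[mu]_(z in [set z | (g z <= g y)%R]) f z)%E.

Lemma measurable_sublevel (r : R) : measurable [set z | g z <= r].
Proof.
have -> : [set z | g z <= r] = setT `&` g @^-1` `]-oo, r].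
  by rewrite setTI; apply/seteqP; split=> z /=; rewrite in_itv.
exact: mg.
Qed.

(** If [g] attains a maximum on [D] at [y], then [D] lies in the sublevel set defining [H y].
    Otherwise [D] is a countable increasing union of sets, each empty or contained in the sublevel
    set of some point of [D], and monotone convergence applies. *)
Lemma integral_sublevel_le (D : set T) (t : R) : 0 <= t -> measurable D ->
  (forall y z, D y -> g z <= g y -> D z) ->
  (forall y, D y -> (H y <= t%:E)%E) -> (\int[mu]_(y in D) f y <= t%:E)%E.
Proof.
move=> t0 mD Ddown lemax.
have [[y [Dy ymax]]|nomax] :=
    pselect (exists y, D y /\ forall z, D z -> g z <= g y).
  apply: le_trans (lemax y Dy); apply: ge0_subset_integral => //.
  - exact: measurable_sublevel.
  - exact: measurable_funTS.
have larger y : D y -> exists2 z, D z & g y < g z.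
  move=> Dy; apply: contrapT => h; apply: nomax; exists y; split=> // z Dz.
  by rewrite leNgt; apply/negP => yz; apply: h; exists z.
(* The levels are sup - 1/(n+1) if [g] is bounded above on [D], and n otherwise. The empty
   alternative serves [D = set0]. *)
have [s [smono Ds sD]] : exists s : nat -> R,
    [/\ {homo s : n m / (n <= m)%N >-> n <= m},
        forall y, D y -> exists n, g y <= s n &
        forall n, (exists2 y, D y & s n <= g y) \/
                  [set z | g z <= s n] `&` D = set0].
  have [ubD|nubD] := pselect (has_ubound (g @` D)).
    exists (fun n => sup (g @` D) - n.+1%:R^-1); split.
    - by move=> n m nm; rewrite lerD2l lerN2 lef_pV2 ?posrE// ler_nat.
    - move=> y /larger[z Dz yz].
      have yS : g y < sup (g @` D).
        by apply: (lt_le_trans yz); apply: ub_le_sup => //; exists z.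
      by have [n yn] := ltr_add_invr yS; exists n; rewrite lerBrDr ltW.
    - move=> n; have [D0|/set0P[y Dy]] := eqVneq D set0.
        by right; rewrite D0 setI0.
      left; have hs : has_sup (g @` D) by split => //; exists (g y), y.
      have n0 : (0 < n.+1%:R^-1 :> R) by rewrite invr_gt0.
      have [_ [z Dz <-] hz] := sup_adherent n0 hs.
      by exists z => //; exact: ltW.
  exists (fun n => n%:R); split.
  - by move=> n m; rewrite ler_nat.
  - move=> y _; have [n _ yn] := @nbhs_infty_ger R (g y).
    by exists n; exact: (yn n (leqnn n)).
  - move=> n; left; apply: contrapT => h; apply: nubD.
    exists n%:R => _ [y Dy <-].
    by rewrite leNgt; apply/negP => ny; apply: h; exists y => //; exact: ltW.
have DE : D = \bigcup_n ([set z | g z <= s n] `&` D).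
  apply/seteqP; split=> [y Dy|y [n _ []]//].
  by have [n yn] := Ds y Dy; exists n.
rewrite DE.
have mA n : measurable ([set z | g z <= s n] `&` D).
  by apply: measurableI => //; exact: measurable_sublevel.
have cv := @ge0_nondecreasing_set_cvg_integral _ _ _
  (fun n => [set z | g z <= s n] `&` D) f mu.
apply: (cvge_le _ (cv _ _ _ _)) => //.
- apply: nearW => n; have [[y Dy sy]|->] := sD n; last first.
    by rewrite integral_set0 lee_fin.
  apply: le_trans (lemax y Dy); apply: ge0_subset_integral => //.
  + exact: measurable_sublevel.
  + exact: measurable_funTS.
  + by move=> z [/= zs _]; exact: le_trans zs sy.
- move=> n m nm; apply/subsetPset => z [/= zn Dz]; split => //=.
  exact: le_trans zn (smono _ _ nm).
- by move=> n; exact: measurable_funTS.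
Qed.

End sublevel.

Section cumulative.
Context (d : measure_display) (T : measurableType d) (R : realType)
  (mu : {measure set T -> \bar R}) (f : T -> \bar R) (g : T -> R).
Hypothesis mf : measurable_fun [set: T] f.
Hypothesis f0 : forall x, (0 <= f x)%E.
Hypothesis mg : measurable_fun [set: T] g.

Let H (y : T) := (\int[mu]_(z in [set z | (g z <= g y)%R]) f z)%E.
Hypothesis Hfin : forall y, (H y < +oo)%E.

Let le_H (y z : T) : g z <= g y -> (H z <= H y)%E.
Proof.
move=> zy; apply: ge0_subset_integral => //.
- exact: measurable_sublevel.
- exact: measurable_sublevel.
- exact: measurable_funTS.
- by move=> x /= /le_trans; apply.
Qed.

Let H_fin_num (y : T) : H y \is a fin_num.
Proof. by rewrite ge0_fin_numE//; exact: integral_ge0. Qed.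

Let le_fineH (y z : T) : g z <= g y -> fine (H z) <= fine (H y).
Proof. by move=> zy; apply: fine_le => //; exact: le_H. Qed.

(** [fine (H y)] depends on [y] through [g y] only, and monotonically, so []-oo, t[] pulls back to
    the preimage under [g] of an interval. *)
Lemma measurable_cumulative : measurable_fun [set: T] (fun y => fine (H y)).
Proof.
apply: (measurability _ (RGenInftyO.measurableE R)) => //.
move=> _ [_ [t ->] <-]; rewrite setTI.
pose I := [set s : R | exists2 y, s <= g y & fine (H y) < t].
have -> : (fun y => fine (H y)) @^-1` `]-oo, t[ = setT `&` g @^-1` I.
  rewrite setTI; apply/seteqP; split=> y /=; rewrite in_itv /=.
    by move=> yt; exists y.
  by move=> [z yz]; apply: le_lt_trans; exact: le_fineH.
apply: mg => //; apply: is_interval_measurable => s r _ [y ry yt] x /andP[_ xr].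
by exists y => //; exact: le_trans ry.
Qed.

(** This is the analogue of the integral of (a + t)^(-q) over t > 0. As the cumulative integral [H]
    may jump, a dyadic decomposition of its values replaces a change of variables. *)
Lemma integral_powR_cumulative (a q : R) : 0 < a -> 1 < q ->
  (\int[mu]_y (((a + fine (H y)) `^ (- q))%:E * f y) <=
   (2 / (1 - 2 `^ (1 - q)) * a `^ (1 - q))%:E)%E.
Proof.
move=> a0 q1; pose h y := a + fine (H y).
have mh : measurable_fun [set: T] h.
  by apply: measurable_funD => //; exact: measurable_cumulative.
have ah y : a <= h y by rewrite lerDl fine_ge0// integral_ge0.
(* Dyadic level sets of h: by [integral_sublevel_le] the integral of f over
   [E j] is at most 2 ^ (j + 1) a. *)
pose E j := [set y | 2 ^+ j * a <= h y < 2 ^+ j.+1 * a].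
have p2 j : 0 < 2 ^+ j * a by rewrite mulr_gt0 ?exprn_gt0.
have mlt t : measurable [set y | h y < t].
  have -> : [set y | h y < t] = setT `&` h @^-1` `]-oo, t[.
    by rewrite setTI; apply/seteqP; split=> y /=; rewrite in_itv.
  exact: mh.
have mE j : measurable (E j).
  have -> : E j = [set y | h y < 2 ^+ j.+1 * a] `\` [set y | h y < 2 ^+ j * a].
    apply/seteqP; split=> y /=.
      by move=> /andP[h1 h2]; split=> //; apply/negP; rewrite -leNgt.
    by move=> [h1 /negP]; rewrite -leNgt => h2; rewrite /E /= h1 h2.
  exact: measurableD.
have EU : [set: T] = \bigcup_j E j.
  apply/seteqP; split=> // y _.
  have [N hN] : exists N, h y < 2 ^+ N * a.
    have [N _ hN] := @nbhs_infty_gtr R (h y / a).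
    exists N; rewrite -ltr_pdivrMr//; apply: (lt_le_trans (hN N (leqnn N))).
    by rewrite -natrX ler_nat ltnW// ltn_expl.
  have ex : exists N, h y < 2 ^+ N * a by exists N.
  (* The least such [N] is positive because [a <= h y]; its predecessor is the index of the level
     set. *)
  case: (ex_minnP ex) => -[|k] hk kmin.
    by move: hk; rewrite expr0 mul1r ltNge ah.
  exists k => //; rewrite /E /= hk andbT leNgt; apply/negP => /kmin.
  by rewrite ltnn.
have tE : trivIset setT E.
  apply/trivIsetP => i j _ _ ij; apply/seteqP; split => // y /= [].
  rewrite /E /= => /andP[i1 i2] /andP[j1 j2].
  have key k l : 2 ^+ k * a <= h y -> h y < 2 ^+ l.+1 * a -> (k <= l)%N.
    move=> h1 h2; have := le_lt_trans h1 h2.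
    by rewrite ltr_pM2r// ltr_eXn2l ?ltr1n// ltnS.
  by move/eqP: ij; apply; apply/eqP; rewrite eqn_leq !key.
have mk : measurable_fun [set: T] (fun y => ((h y `^ (- q))%:E * f y)%E).
  apply: emeasurable_funM => //; apply/measurable_EFinP.
  exact: (measurableT_comp (measurable_powR (- q)) mh).
have k0 y : (0 <= (h y `^ (- q))%:E * f y)%E.
  by rewrite mule_ge0// lee_fin powR_ge0.
set z : R := 2 `^ (1 - q).
have z0 : 0 < z by exact: powR_gt0.
have z1 : z < 1 by exact: powR_lt1_gt1.
(* On [E j] the weight is at most (2^j a)^(-q) and the integral of [f] at most 2^(j+1) a. The
   product 2 a^(1-q) z^j is a term of a geometric series. *)
have Ej j : (\int[mu]_(y in E j) ((h y `^ (- q))%:E * f y) <=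
    ((2 * a `^ (1 - q)) * z ^+ j)%:E)%E.
  apply: (@le_trans _ _
    (\int[mu]_(y in E j) (((2 ^+ j * a) `^ (- q))%:E * f y))%E).
    apply: ge0_le_integral_nonmeasurable => // y; rewrite /E/= => /andP[hy _].
    apply: lee_wpmul2r => //; rewrite lee_fin.
    by apply: ler_powRN => //; rewrite ltW// (lt_trans ltr01).
  rewrite ge0_integralZl//; last 2 first.
  - exact: measurable_funTS.
  - by rewrite lee_fin powR_ge0.
  apply: (@le_trans _ _ (((2 ^+ j * a) `^ (- q))%:E * (2 ^+ j.+1 * a)%:E)%E).
    apply: lee_wpmul2l; first by rewrite lee_fin powR_ge0.
    apply: (@le_trans _ _
      (\int[mu]_(y in [set y | h y < 2 ^+ j.+1 * a]%R) f y)%E).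
      apply: ge0_subset_integral => //; first exact: measurable_funTS.
      by move=> y /andP[].
    apply: (integral_sublevel_le mf f0 mg) => //; first exact: ltW.
      move=> y x /= hy xy; apply: le_lt_trans hy.
      by rewrite lerD2l; exact: le_fineH.
    move=> y /= hy; rewrite -/(H y) -(fineK (H_fin_num y)) lee_fin.
    by apply: le_trans (ltW hy); rewrite lerDr ltW.
  rewrite -EFinM lee_fin.
  have -> : 2 ^+ j.+1 * a = 2 * (2 ^+ j * a) by rewrite exprS mulrA.
  rewrite mulrCA -mulrA ler_pM2l// -{2}[2 ^+ j * a](powRr1 (ltW (p2 j))).
  rewrite -powRD; last by rewrite (gt_eqF (p2 j)) implybT.
  rewrite addrC powRM; [|exact: exprn_ge0|exact: ltW].
  rewrite mulrC ler_pM2l ?powR_gt0//.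
  by rewrite -powR_mulrn// -powRrM mulrC powRrM powR_mulrn ?powR_ge0.
rewrite EU ge0_integral_bigcup//; first last.
- by move=> y _; exact: k0.
- by rewrite -EU.
apply: (@le_trans _ _ (\sum_(j <oo) ((2 * a `^ (1 - q)) * z ^+ j)%:E)%E).
  apply: lee_nneseries => [j *|j *]; last exact: Ej.
  by apply: integral_ge0 => y _; exact: k0.
apply: lime_le.
  apply: is_cvg_nneseries => j _ _.
  by rewrite lee_fin !mulr_ge0 ?exprn_ge0 ?powR_ge0// ltW.
apply: nearW => k; rewrite sumEFin lee_fin.
have -> : \sum_(0 <= i < k) (2 * a `^ (1 - q) * z ^+ i) =
    series (geometric (2 * a `^ (1 - q)) z) k by [].
rewrite geometric_seriesE ?lt_eqF//= [leRHS]mulrAC.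
rewrite ler_pM2r ?invr_gt0 ?subr_gt0//.
by rewrite ler_piMr ?mulr_ge0 ?powR_ge0// gerBl exprn_ge0// ltW.
Qed.

End cumulative.

(** * Layer-cake formulas for powers *)

Lemma integral_powR_tail (R : realType) (b a : R) : 0 < b -> 0 < a ->
  (\int[@lebesgue_measure R]_(s in `[a, +oo[) ((s `^ (b + 1))^-1)%:E =
   (b^-1 * a `^ (- b))%:E)%E.
Proof.
move=> b0 a0.
pose F (s : R) := - b^-1 * s `^ (- b).
have dF (x : R) : 0 < x -> is_derive x 1 F ((x `^ (b + 1))^-1).
  move=> x0.
  have -> : (x `^ (b + 1))^-1 = - b^-1 *: (- b * x `^ (- b - 1)).
    by rewrite /GRing.scale /= mulrA mulrNN mulVf ?gt_eqF// mul1r -powRN opprD.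
  have := is_derive1_powR (- b) x0; exact: is_deriveZ.
have cF (x : R) : 0 < x -> {for x, continuous F}.
  move=> x0; apply/differentiable_continuous; apply/derivable1_diffP.
  exact: (@ex_derive _ _ _ _ _ _ _ (dF x x0)).
have cpow (p x : R) : 0 < x -> {for x, continuous (fun s => s `^ p)}.
  move=> x0; apply/differentiable_continuous; apply/derivable1_diffP.
  exact: (@ex_derive _ _ _ _ _ _ _ (is_derive1_powR p x0)).
rewrite (@ge0_continuous_FTC2y R (fun s => (s `^ (b + 1))^-1) F a 0).
- by rewrite sub0e -EFinN /F mulNr opprK.
- by move=> x ax; rewrite invr_ge0 powR_ge0.
- apply: continuous_in_subspaceT => x; rewrite inE /= in_itv /= andbT => ax.
  have x0 := lt_le_trans a0 ax.
  have -> : (fun s => (s `^ (b + 1))^-1) = (fun s => s `^ (- (b + 1))).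
    by apply/funext => s; rewrite powRN.
  exact: cpow.
- rewrite -[X in _ --> X](mulr0 (- b^-1)); apply: cvgMl_tmp.
  have -> : (fun x : R => x `^ (- b)) = (fun x => (x `^ b)^-1).
    by apply/funext => x; rewrite powRN.
  apply/gtr0_cvgV0.
    by near=> x; apply: powR_gt0; near: x; exact: nbhs_pinfty_gt.
  apply/cvgryPge => A.
  near=> x.
  have A0 : 0 <= Num.max A 0 by rewrite le_max lexx orbT.
  apply: (@le_trans _ _ (Num.max A 0)); first by rewrite le_max lexx.
  rewrite -[leLHS](powRr1 A0) -(mulVf (lt0r_neq0 b0)) powRrM.
  apply: ge0_ler_powR; rewrite ?nnegrE ?powR_ge0 ?(ltW b0)//.
- by move=> x ax; exact: (@ex_derive _ _ _ _ _ _ _ (dF x (lt_trans a0 ax))).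
- by apply: cvg_at_right_filter; exact: cF.
- move=> x; rewrite in_itv /= andbT => ax.
  rewrite derive1E.
  exact: (@derive_val _ _ _ _ _ _ _ (dF x (lt_trans a0 ax))).
Unshelve. all: by end_near. Qed.

(** On this interval of length [t] the integrand is at least its value at the right end [2 * t]. *)
Lemma integral_powR_dyadic_ge (R : realType) (b t : R) : 0 < b -> 0 < t ->
  ((2 `^ (- (b + 1)) * t `^ (- b))%:E <=
   \int[@lebesgue_measure R]_(s in `]t, (2 * t)%R]) ((s `^ (b + 1))^-1)%:E)%E.
Proof.
move=> b0 t0.
apply: (@le_trans _ _ (\int[@lebesgue_measure R]_(s in `]t, (2 * t)%R])
   ((2 * t) `^ (- (b + 1)))%:E)%E).
  rewrite integral_cst//= lebesgue_measure_itv /= lte_fin ltr_pMl// ltr1n.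
  rewrite -EFinB -EFinM lee_fin powRM ?(ltW t0)// -mulrA ler_pM2l ?powR_gt0//.
  have -> : 2 * t - t = t by ring.
  rewrite -{3}(powRr1 (ltW t0)) -powRD; last by rewrite (gt_eqF t0) implybT.
  by rewrite opprD addrNK.
apply: ge0_le_integral_nonmeasurable => s; rewrite /= in_itv /= => /andP[ts st].
  by rewrite lee_fin powR_ge0.
rewrite lee_fin -powRN; apply: ler_powRN => //; first by rewrite addr_ge0// ltW.
exact: lt_trans ts.
Qed.

(** Both sides are iterated integrals of [k s] over the region [g y < s], s in [I]; Tonelli's
    theorem exchanges them. *)
Lemma integral_sublevel_weight (d : measure_display) (T : measurableType d)
    (R : realType) (sigma : {sigma_finite_measure set T -> \bar R})
    (g : T -> R) (k : R -> R) (I : set R) :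
  measurable_fun [set: T] g -> measurable_fun [set: R] k ->
  (forall s, 0 <= k s) -> measurable I ->
  (\int[@lebesgue_measure R]_(s in I) (sigma [set y | (g y < s)%R] * (k s)%:E) =
   \int[sigma]_y \int[@lebesgue_measure R]_(s in I `&` `]g y, +oo[) (k s)%:E)%E.
Proof.
move=> mg mk k0 mI.
pose A := [set p : R * T | g p.2 < p.1].
have mA : measurable A.
  have mh : measurable_fun [set: R * T] (fun p => p.1 - g p.2).
    apply: measurable_funB; first exact: measurable_fst.
    by apply: measurableT_comp => //; exact: measurable_snd.
  have -> : A = setT `&` (fun p => p.1 - g p.2) @^-1` `]0, +oo[.
    rewrite setTI; apply/seteqP.
    by split=> p; rewrite /A /= in_itv /= andbT subr_gt0.
  exact: mh.
pose f (p : R * T) : \bar R := (\1_A p * (\1_I p.1 * k p.1))%:E.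
have mf : measurable_fun [set: R * T] f.
  apply/measurable_EFinP; apply: measurable_funM; first exact: measurable_indic.
  apply: (measurableT_comp (f := fun s => \1_I s * k s)); last first.
    exact: measurable_fst.
  by apply: measurable_funM => //; exact: measurable_indic.
have f0 p : (0 <= f p)%E by rewrite lee_fin !mulr_ge0// ?indicE ?ler0n.
rewrite integral_mkcond.
transitivity (\int[@lebesgue_measure R]_s \int[sigma]_y f (s, y))%E.
  apply: eq_integral => s _; rewrite /f /=.
  have mAs : measurable [set y | g y < s].
    have -> : [set y | g y < s] = setT `&` g @^-1` `]-oo, s[.
      by rewrite setTI; apply/seteqP; split=> y /=; rewrite in_itv.
    exact: mg.
  transitivity (\int[sigma]_y
    ((\1_I s * k s)%:E * (\1_[set y | g y < s] y)%:E))%E.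
    rewrite ge0_integralZl//; last by rewrite lee_fin mulr_ge0// indicE ler0n.
    rewrite integral_indic// setIT /patch indicE; case: (s \in I).
      by rewrite mul1r muleC.
    by rewrite mul0r mul0e.
    by apply/measurable_EFinP; exact: measurable_indic.
  by apply: eq_integral => y _; rewrite -EFinM mulrC !indicE /A.
rewrite (@fubini_tonelli _ _ _ _ R (@lebesgue_measure R) sigma f mf f0).
apply: eq_integral => y _; rewrite [RHS]integral_mkcond.
apply: eq_integral => s _.
rewrite /f /patch !indicE in_setI.
have -> : ((s, y) \in A) = (g y < s) by apply/idP/idP; rewrite inE.
have -> : (s \in [set` `]g y, +oo[]) = (g y < s).
  by apply/idP/idP; rewrite inE /= in_itv /= andbT.
by case: (g y < s); case: (s \in I); rewrite /= ?mul0r ?mul1r.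
Qed.

(* The value +oo at 0 is what makes [G x y] comparable to [riesz gamma (d x y)]
   on the diagonal too, where [0 `^ (- gamma)] is 0. *)
Definition riesz (R : realType) (b r : R) : \bar R :=
  if r == 0 then +oo%E else (r `^ (- b))%:E.

Lemma riesz_ge0 (R : realType) (b r : R) : (0 <= riesz b r)%E.
Proof. by rewrite /riesz; case: ifP => // _; rewrite lee_fin powR_ge0. Qed.

Lemma rieszE (R : realType) (b r : R) : 0 < r -> riesz b r = (r `^ (- b))%:E.
Proof. by move=> r0; rewrite /riesz gt_eqF. Qed.

Lemma le_riesz (R : realType) (b r s : R) : 0 <= b -> 0 <= r -> r <= s ->
  (riesz b s <= riesz b r)%E.
Proof.
move=> b0; rewrite le_eqVlt => /predU1P[<- _|r0 rs].
  by rewrite {2}/riesz eqxx leey.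
by rewrite !rieszE ?(lt_le_trans r0 rs)// lee_fin ler_powRN.
Qed.

Lemma riesz_double (R : realType) (b r : R) : 0 <= r ->
  riesz b (2 * r) = ((2 `^ (- b))%:E * riesz b r)%E.
Proof.
rewrite le_eqVlt => /predU1P[<-|r0].
  by rewrite mulr0 /riesz eqxx gt0_muley// lte_fin powR_gt0.
by rewrite !rieszE ?mulr_gt0// powRM// ltW.
Qed.

Lemma measurable_riesz (R : realType) (b : R) :
  measurable_fun [set: R] (riesz b).
Proof.
apply: measurable_fun_ifT => //.
  exact: measurable_fun_eqr.
by apply/measurable_EFinP; exact: measurable_powR.
Qed.

Section layer_cake.
Context (disp : measure_display) (T : measurableType disp) (R : realType)
  (sigma : {measure set T -> \bar R}) (g : T -> R) (b : R).
Hypothesis b0 : 0 < b.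
Hypothesis mg : measurable_fun [set: T] g.
Hypothesis g0 : forall y, 0 <= g y.
Hypothesis fing : forall s, (sigma [set y | (g y < s)%R] < +oo)%E.

Let k (s : R) := (s `^ (b + 1))^-1.

Let k0 s : 0 <= k s. Proof. by rewrite invr_ge0 powR_ge0. Qed.

Let mk : measurable_fun [set: R] k.
Proof. exact: measurable_powRV. Qed.

Let mEk (D : set R) : measurable_fun D (fun s => (k s)%:E).
Proof. by apply/measurable_EFinP; exact: measurable_funTS. Qed.

Lemma measurable_strict_sublevel (s : R) : measurable [set y | g y < s].
Proof.
have -> : [set y | g y < s] = setT `&` g @^-1` `]-oo, s[.
  by rewrite setTI; apply/seteqP; split=> y /=; rewrite in_itv.
exact: mg.
Qed.

Lemma integral_sublevel_powR (I : set R) : measurable I ->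
  (\int[@lebesgue_measure R]_(s in I)
     (sigma [set y | (g y < s)%R] * ((s `^ (b + 1))^-1)%:E) =
   \int[sigma]_y \int[@lebesgue_measure R]_(s in I `&` `]g y, +oo[)
     ((s `^ (b + 1))^-1)%:E)%E.
Proof.
move=> mI.
(* Tonelli's theorem asks for a sigma-finite measure; the sets [g y < n] exhaust the space and have
   finite measure. *)
have sf : sigma_finite setT sigma.
  exists (fun n => [set y | g y < n%:R]).
    apply/seteqP; split=> // y _; have [n _ yn] := @nbhs_infty_gtr R (g y).
    by exists n => //; exact: (yn n (leqnn n)).
  by move=> n; split; [exact: measurable_strict_sublevel|exact: fing].
pose sfm := isSigmaFinite.Build _ _ _ sigma sf.
pose s : {sigma_finite_measure set T -> \bar R} :=
  HB.pack_for (SigmaFiniteMeasure.type T R) (Measure.sort sigma) sfm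
    (isSFinite.Build _ _ _ _ (sfinite_measure_sigma_finite sf)).
exact: (@integral_sublevel_weight _ _ _ s g k I mg mk k0 mI).
Qed.

(** Keeping only the window from [t] to [2 * t], which lies above [g y], bounds the inner integral
    of Tonelli's formula from below. *)
Lemma dyadic_le_integral (I : set R) (y : T) (t : R) : measurable I ->
  0 < t -> g y <= t -> `]t, (2 * t)] `<=` I ->
  ((2 `^ (- (b + 1)) * t `^ (- b))%:E <=
   \int[@lebesgue_measure R]_(s in I `&` `]g y, +oo[) ((s `^ (b + 1))^-1)%:E)%E.
Proof.
move=> mI t0 gt tI; apply: le_trans (integral_powR_dyadic_ge b0 t0) _.
apply: ge0_subset_integral => //.
- exact: measurableI.
- exact: mEk.
- by move=> s _; rewrite lee_fin k0.
- move=> s st; split; first exact: tI.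
  move: st; rewrite /= !in_itv /= andbT => /andP[ts _]; exact: le_lt_trans ts.
Qed.

Let mpow (a : R) : measurable_fun [set: T] (fun y => ((a + g y) `^ (- b))%:E).
Proof.
apply/measurable_EFinP; apply: (measurableT_comp (measurable_powR (- b))).
exact: measurable_funD.
Qed.

(** The inner integral starts at the maximum of [a] and [g y], which is at least half of [a + g y];
    the half costs the factor 2^b. *)
Lemma integral_tail_le (a : R) : 0 < a ->
  (\int[@lebesgue_measure R]_(s in `[a, +oo[)
     (sigma [set y | (g y < s)%R] * ((s `^ (b + 1))^-1)%:E) <=
   (b^-1 * 2 `^ b)%:E * \int[sigma]_y ((a + g y) `^ (- b))%:E)%E.
Proof.
move=> a0; rewrite integral_sublevel_powR// -ge0_integralZl//; first last.
- by rewrite lee_fin mulr_ge0 ?powR_ge0// invr_ge0 ltW.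
- by move=> y _; rewrite lee_fin powR_ge0.
apply: ge0_le_integral_nonmeasurable => y _.
  by apply: integral_ge0 => s _; rewrite lee_fin k0.
pose m := Num.max a (g y).
have m0 : 0 < m by rewrite lt_max a0.
apply: (@le_trans _ _ (\int[@lebesgue_measure R]_(s in `[m, +oo[) (k s)%:E)%E).
  apply: ge0_subset_integral => //.
  - exact: measurableI.
  - exact: mEk.
  - by move=> s _; rewrite lee_fin k0.
  - move=> s [] /=; rewrite !in_itv /= !andbT => as_ gs.
    by rewrite ge_max as_ ltW.
rewrite integral_powR_tail// -EFinM lee_fin -mulrA ler_pM2l ?invr_gt0//.
have -> : m `^ (- b) = 2 `^ b * (2 * m) `^ (- b).
  by rewrite powRM ?(ltW m0)// mulrA (powRN 2) mulfV ?mul1r// gt_eqF// powR_gt0.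
rewrite ler_pM2l ?powR_gt0//; apply: ler_powRN; first exact: ltW.
  by rewrite ltr_wpDr.
have -> : 2 * m = m + m by ring.
by rewrite lerD// le_max lexx ?orbT.
Qed.

Lemma integral_tail_ge (a : R) : 0 < a ->
  ((2 `^ (- (b + 1)))%:E * \int[sigma]_y ((a + g y) `^ (- b))%:E <=
   \int[@lebesgue_measure R]_(s in `[a, +oo[)
     (sigma [set y | (g y < s)%R] * ((s `^ (b + 1))^-1)%:E))%E.
Proof.
move=> a0; rewrite integral_sublevel_powR// -ge0_integralZl//; first last.
- by move=> y _; rewrite lee_fin powR_ge0.
apply: ge0_le_integral_nonmeasurable => y _.
  by rewrite -EFinM lee_fin mulr_ge0// powR_ge0.
(* The window starts at [a + g y], which is above both [a] and [g y]. *)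
rewrite -EFinM; apply: dyadic_le_integral => //.
- by rewrite ltr_wpDr.
- by rewrite lerDr ltW.
- move=> s /=; rewrite !in_itv /= andbT => /andP[+ _] => h.
  by apply: ltW; apply: le_lt_trans h; rewrite lerDl.
Qed.

Let mriesz : measurable_fun [set: T] (fun y => riesz b (g y)).
Proof. exact: (measurableT_comp (measurable_riesz b)). Qed.

(** For [g y < r] the inner integral is at most the full tail from [g y], that is
    [b^-1 * riesz b (g y)]; for [g y >= r] its domain is empty. *)
Lemma integral_local_le (r : R) :
  (\int[@lebesgue_measure R]_(s in `]0%R, r])
     (sigma [set y | (g y < s)%R] * ((s `^ (b + 1))^-1)%:E) <=
   (b^-1)%:E * \int[sigma]_(y in [set y | (g y < r)%R]) riesz b (g y))%E.
Proof.
have mr := measurable_strict_sublevel r.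
rewrite integral_sublevel_powR// -ge0_integralZl//; first last.
- by rewrite lee_fin invr_ge0 ltW.
- by move=> y _; exact: riesz_ge0.
- exact: measurable_funTS.
rewrite [leRHS]integral_mkcond; apply: ge0_le_integral_nonmeasurable => y _.
  by apply: integral_ge0 => s _; rewrite lee_fin k0.
rewrite /patch; case: ifPn => [|]; last first.
  rewrite notin_setE /= => /negP; rewrite -leNgt => rg.
  have -> : `]0, r] `&` `]g y, +oo[ = set0 :> set R.
    apply/seteqP; split=> s //= []; rewrite !in_itv /= andbT => /andP[_ sr] gs.
    by have := le_lt_trans (le_trans sr rg) gs; rewrite ltxx.
  by rewrite integral_set0.
rewrite inE /= => gr.
have := g0 y; rewrite le_eqVlt => /predU1P[<-|gy0].
  by rewrite /riesz eqxx gt0_muley ?leey// lte_fin invr_gt0.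
rewrite rieszE// -EFinM -integral_powR_tail//.
apply: ge0_subset_integral => //.
- exact: measurableI.
- exact: mEk.
- by move=> s _; rewrite lee_fin k0.
- by move=> s [_] /=; rewrite !in_itv /= !andbT => /ltW.
Qed.

(** For 0 < g y < r the window from g y to 2 g y fits below 2 r, whence the doubled upper limit. For
    g y = 0 windows at arbitrarily small t make the inner integral infinite, in accordance with
    [riesz b 0]. *)
Lemma integral_local_ge (r : R) : 0 < r ->
  ((2 `^ (- (b + 1)))%:E *
     \int[sigma]_(y in [set y | (g y < r)%R]) riesz b (g y) <=
   \int[@lebesgue_measure R]_(s in `]0%R, (2 * r)%R])
     (sigma [set y | (g y < s)%R] * ((s `^ (b + 1))^-1)%:E))%E.
Proof.
move=> r0; have mr := measurable_strict_sublevel r.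
rewrite integral_sublevel_powR// -ge0_integralZl//; first last.
- by move=> y _; exact: riesz_ge0.
- exact: measurable_funTS.
rewrite [leLHS]integral_mkcond; apply: ge0_le_integral_nonmeasurable => y _.
  rewrite /patch; case: ifP => // _.
  by rewrite mule_ge0 ?riesz_ge0// lee_fin powR_ge0.
rewrite /patch; case: ifPn => [|_]; last first.
  by apply: integral_ge0 => s _; rewrite lee_fin k0.
rewrite inE /= => gr.
have dyadic t : 0 < t -> g y <= t -> t <= r ->
    ((2 `^ (- (b + 1)) * t `^ (- b))%:E <=
     \int[@lebesgue_measure R]_(s in `]0%R, (2 * r)%R] `&` `]g y, +oo[)
       (k s)%:E)%E.
  move=> t0 gt tr; apply: dyadic_le_integral => // s /=; rewrite !in_itv /=.
  move=> /andP[ts st]; rewrite (lt_trans t0 ts)/=; apply: le_trans st _.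
  by rewrite ler_pM2l.
have := g0 y; rewrite le_eqVlt => /predU1P[gy0|gy0]; last first.
  by rewrite rieszE// -EFinM; apply: dyadic => //; exact: ltW.
have -> : (\int[@lebesgue_measure R]_(s in `]0%R, (2 * r)%R] `&` `]g y, +oo[)
    (k s)%:E = +oo)%E; last by rewrite leey.
apply/eqyP => A A0.
pose B := A / 2 `^ (- (b + 1)).
have B0 : 0 < B by rewrite divr_gt0// powR_gt0.
(* The second entry makes 2^(-(b+1)) t^(-b) at least [A]; the first keeps the window below
   [2 * r]. *)
pose t := Num.min r (B `^ (- b^-1)).
have t0 : 0 < t by rewrite lt_min r0 powR_gt0.
apply: le_trans (dyadic t t0 _ _); last 2 first.
- by rewrite -gy0 ltW.
- by rewrite ge_min lexx.
rewrite lee_fin -ler_pdivrMl ?powR_gt0// mulrC -/B.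
have -> : B = (B `^ (- b^-1)) `^ (- b).
  by rewrite -powRrM mulrNN mulVf ?gt_eqF// powRr1// ltW.
by apply: ler_powRN => //; [exact: ltW|rewrite ge_min lexx orbT].
Qed.

End layer_cake.

(** * Supersolutions for the kernel [riesz] of a metric *)

Section metric_measure.
Context (disp : measure_display) (T : measurableType disp) (R : realType)
  (sigma : {measure set T -> \bar R}) (d : T -> T -> R) (gamma q : R).
Hypothesis d_metric : is_metric d.
Hypothesis md : forall x, measurable_fun [set: T] (d x).
Hypothesis gamma0 : 0 < gamma.
Hypothesis q1 : 1 < q.

Let d_ge0 x y : 0 <= d x y. Proof. by have [h _ _ _] := d_metric. Qed.

Let d_sym x y : d x y = d y x. Proof. by have [_ _ h _] := d_metric. Qed.

Let d_triangle x y z : d x z <= d x y + d y z.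
Proof. by have [_ _ _ h] := d_metric. Qed.

Let d_refl x : d x x = 0. Proof. by have [_ h _ _] := d_metric; apply/h. Qed.

Let q0 : 0 < q. Proof. exact: lt_trans ltr01 q1. Qed.

Let gq0 : 0 < gamma * q. Proof. exact: mulr_gt0. Qed.

Let measurable_ball x r : measurable (metric_ball d x r).
Proof. exact: measurable_strict_sublevel. Qed.

Let measurable_riesz_d x :
  measurable_fun [set: T] (fun y => riesz gamma (d x y)).
Proof. exact: (measurableT_comp (measurable_riesz gamma)). Qed.

Let measurable_powR_d (a p : R) (o : T) :
  measurable_fun [set: T] (fun y => ((a + d o y) `^ p)%:E).
Proof.
apply/measurable_EFinP; apply: (measurableT_comp (measurable_powR p)).
exact: measurable_funD.
Qed.

Definition tail_condition (o : T) (r0 : R) : Prop :=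
  (\int[@lebesgue_measure R]_(t in `[r0, +oo[)
    (sigma (metric_ball d o t) * ((t `^ (gamma * q + 1))^-1)%:E) < +oo)%E.

Definition local_condition (o : T) (r0 C : R) : Prop := forall r : R, r0 < r ->
  (ereal_sup [set \int[@lebesgue_measure R]_(s in `]0%R, r])
                (sigma (metric_ball d x s) * ((s `^ (gamma + 1))^-1)%:E)
             | x in metric_ball d o r]
   <= (C * r `^ (gamma * (q - 1)))%:E)%E.

Let finite_balls_center (o x : T) :
  (forall t, (sigma (metric_ball d o t) < +oo)%E) ->
  forall s, (sigma [set y | (d x y < s)%R] < +oo)%E.
Proof.
move=> fin s; apply: le_lt_trans (fin (d o x + s)).
apply: le_measure; rewrite ?inE; first exact: measurable_ball.
  exact: measurable_ball.
by move=> y /= xy; apply: (le_lt_trans (d_triangle o x y)); rewrite ltrD2l.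
Qed.

(** * Sufficiency: the potential of a power of the distance to [o] *)

Section sufficiency.
Context (o : T) (r0 C : R).
Hypothesis r00 : 0 < r0.
Hypothesis C0 : 0 < C.
Hypothesis tail : tail_condition o r0.
Hypothesis local : local_condition o r0 C.

(** A ball of infinite measure would make all larger concentric balls infinite, and with them the
    tail integral. *)
Lemma tail_finite_ball (t : R) : (sigma (metric_ball d o t) < +oo)%E.
Proof.
rewrite ltey; apply/eqP => st.
move: tail; rewrite /tail_condition; apply/negP; rewrite -leNgt.
pose m := Num.max t r0.
have m0 : 0 < m by rewrite lt_max r00 orbT.
have b0 : 0 < gamma * q by [].
pose k (s : R) := ((s `^ (gamma * q + 1))^-1)%:E.
apply: (@le_trans _ _
  (+oo * \int[@lebesgue_measure R]_(s in `]m, (2 * m)%R]) k s)%E).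
  rewrite gt0_mulye//; apply: lt_le_trans (integral_powR_dyadic_ge b0 m0).
  by rewrite lte_fin mulr_gt0// powR_gt0.
have mk : measurable_fun `]m, (2 * m)%R] k.
  apply/measurable_EFinP; apply: measurable_funTS.
  exact: measurable_powRV.
rewrite -ge0_integralZl//; last first.
  by move=> s _; rewrite lee_fin invr_ge0 powR_ge0.
apply: ge0_subset_le_integral.
- move=> s /=; rewrite !in_itv /= andbT => /andP[/ltW + _].
  by apply: le_trans; rewrite le_max lexx orbT.
- by move=> s _; rewrite mule_ge0// lee_fin invr_ge0 powR_ge0.
- by move=> s _; rewrite mule_ge0// lee_fin invr_ge0 powR_ge0.
- move=> s /=; rewrite in_itv /= => /andP[ms _].
  apply: lee_wpmul2r; first by rewrite lee_fin invr_ge0 powR_ge0.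
  rewrite -st; apply: le_measure; rewrite ?inE; first exact: measurable_ball.
    exact: measurable_ball.
  move=> y /= oy; apply: lt_trans ms; apply: lt_le_trans oy _.
  by rewrite le_max lexx.
Qed.

(** Let X = r0 + d o x. Far from [x] the kernel is O(X^(-gamma)) and the weight is integrable by the
    tail condition. Near [x] the weight is O(X^(-gamma q)), and by the local condition the kernel
    has integral O(X^(gamma (q - 1))); the product is again O(X^(-gamma)). *)
Lemma riesz_potential_le : exists2 B : R, 0 < B & forall x,
  (\int[sigma]_y (riesz gamma (d x y) * ((r0 + d o y) `^ (- (gamma * q)))%:E) <=
   (B * (r0 + d o x) `^ (- gamma))%:E)%E.
Proof.
have fin x s : (sigma [set y | (d x y < s)%R] < +oo)%E.
  by apply: finite_balls_center; exact: tail_finite_ball.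
pose v y := (r0 + d o y) `^ (- (gamma * q)).
have p0 y : 0 < r0 + d o y by rewrite ltr_wpDr.
have v0 y : (0 <= (v y)%:E)%E by rewrite lee_fin powR_ge0.
have mv : measurable_fun [set: T] (fun y => (v y)%:E).
  exact: measurable_powR_d.
have Jfin : (\int[sigma]_y (v y)%:E < +oo)%E.
  have := le_lt_trans (integral_tail_ge gq0 (md o) (d_ge0 o) (fin o) r00) tail.
  move=> h; rewrite ltey; apply: contraTneq h => Jy.
  by rewrite Jy gt0_muley ?ltxx// lte_fin powR_gt0.
pose J := fine (\int[sigma]_y (v y)%:E).
have J0 : 0 <= J by rewrite fine_ge0// integral_ge0.
have JE : (\int[sigma]_y (v y)%:E = J%:E)%E.
  by rewrite fineK// ge0_fin_numE// integral_ge0.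
(* [integral_local_ge] at radius [X] gives the factor 2^(gamma+1) and the upper limit [2 * X], at
   which the local condition supplies the rest. *)
pose C1 := 2 `^ (gamma + 1) * (C * 2 `^ (gamma * (q - 1))).
have C10 : 0 < C1 by rewrite !mulr_gt0// powR_gt0.
exists (2 `^ gamma * J + 2 `^ (gamma * q) * C1).
  by rewrite ltr_wpDl ?mulr_ge0 ?powR_ge0// mulr_gt0// powR_gt0.
move=> x; set X := r0 + d o x.
have X0 : 0 < X by exact: p0.
have Lx : (\int[sigma]_(y in metric_ball d x X) riesz gamma (d x y) <=
    (C1 * X `^ (gamma * (q - 1)))%:E)%E.
  have h1 := integral_local_ge gamma0 (md x) (d_ge0 x) (fin x) X0.
  have r2X : r0 < 2 * X.
    apply: (@le_lt_trans _ _ X); first by rewrite lerDl.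
    by rewrite ltr_pMl// ltr1n.
  have h2 := local r2X.
  have : (\int[@lebesgue_measure R]_(s in `]0%R, (2 * X)%R])
     (sigma (metric_ball d x s) * ((s `^ (gamma + 1))^-1)%:E) <=
     (C * (2 * X) `^ (gamma * (q - 1)))%:E)%E.
    apply: le_trans h2; apply: ereal_sup_ubound; exists x => //=.
    apply: (@lt_trans _ _ X); first by rewrite ltrDr.
    by rewrite ltr_pMl// ltr1n.
  move=> /(le_trans h1); rewrite powRN -lee_pdivlMl; last first.
    by rewrite invr_gt0 powR_gt0.
  by rewrite invrK -EFinM powRM ?(ltW X0)// /C1 !mulrA.
pose D := metric_ball d x (X / 2).
have mD : measurable D by exact: measurable_ball.
(* [f1] majorises the integrand off [D], where the kernel is at most (X/2)^(-gamma); [f2] majorises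
   it on [D], where r0 + d o y is at least X/2. *)
pose f1 y := ((2 `^ gamma * X `^ (- gamma))%:E * (v y)%:E)%E.
pose f2 := (fun y => (2 `^ (gamma * q) * X `^ (- (gamma * q)))%:E *
  riesz gamma (d x y))%E \_ D.
have f10 y : (0 <= f1 y)%E by rewrite mule_ge0// lee_fin mulr_ge0 ?powR_ge0.
have f20 y : (0 <= f2 y)%E.
  rewrite /f2 /patch; case: ifP => // _.
  by rewrite mule_ge0 ?riesz_ge0// lee_fin mulr_ge0 ?powR_ge0.
have mf1 : measurable_fun [set: T] f1 by exact: measurable_funeM.
have mf2 : measurable_fun [set: T] f2.
  apply/(measurable_restrictT _ _).1 => //; apply: measurable_funTS.
  exact: measurable_funeM.
apply: (@le_trans _ _ (\int[sigma]_y (f1 y + f2 y))%E).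
  apply: ge0_le_integral_nonmeasurable => y _.
    by rewrite mule_ge0 ?riesz_ge0// lee_fin powR_ge0.
  rewrite -/(v y); have [yD|yD] := pselect (D y).
    apply: (@le_trans _ _ (f2 y)); last by rewrite leeDr.
    rewrite /f2 /patch mem_set// muleC.
    apply: lee_wpmul2r; first exact: riesz_ge0.
    rewrite lee_fin /v.
    have -> : 2 `^ (gamma * q) * X `^ (- (gamma * q)) =
        (X / 2) `^ (- (gamma * q)).
      rewrite powRM ?(ltW X0)// mulrC; congr (_ * _).
      by rewrite -powR_inv1// -powRrM mulrNN mul1r.
    apply: ler_powRN; [exact: ltW|by rewrite divr_gt0|].
    have := d_triangle o y x; rewrite (d_sym y x).
    move: yD; rewrite /D /metric_ball /= /X => h1 h2; lra.
  apply: (@le_trans _ _ (f1 y)); last by rewrite leeDl.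
  rewrite /f1; apply: lee_wpmul2r => //.
  move/negP: yD; rewrite -leNgt => yD.
  have X2 : 0 < X / 2 by rewrite divr_gt0.
  apply: (@le_trans _ _ (riesz gamma (X / 2))).
    by apply: le_riesz yD; exact: ltW.
  rewrite rieszE// powRM ?(ltW X0)// mulrC lee_fin.
  by rewrite -(powR_inv1 (ler0n _ 2)) -powRrM mulrNN mul1r.
rewrite ge0_integralD// ge0_integralZl//; last first.
  by rewrite lee_fin mulr_ge0 ?powR_ge0.
rewrite JE -EFinM mulrDl EFinD; apply: leeD.
  by rewrite lee_fin mulrAC.
rewrite /f2 -integral_mkcond ge0_integralZl//; last 3 first.
- exact: measurable_funTS.
- by move=> y _; exact: riesz_ge0.
- by rewrite lee_fin mulr_ge0 ?powR_ge0.
apply: (@le_trans _ _ ((2 `^ (gamma * q) * X `^ (- (gamma * q)))%:E *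
    (C1 * X `^ (gamma * (q - 1)))%:E)%E).
  apply: lee_wpmul2l; first by rewrite lee_fin mulr_ge0 ?powR_ge0.
  apply: le_trans Lx; apply: ge0_subset_integral => //.
  - exact: measurable_funTS.
  - by move=> y _; exact: riesz_ge0.
  - move=> y /= h; apply: (lt_le_trans h).
    by rewrite ler_pdivrMr// ler_peMr ?(ltW X0)// ler1n.
rewrite -EFinM lee_fin.
have -> : 2 `^ (gamma * q) * X `^ (- (gamma * q)) *
      (C1 * X `^ (gamma * (q - 1))) =
    2 `^ (gamma * q) * C1 *
      (X `^ (- (gamma * q)) * X `^ (gamma * (q - 1))) by ring.
rewrite -powRD; last by rewrite (gt_eqF X0) implybT.
by rewrite mulrBr mulr1 addrA addNr add0r.
Qed.

End sufficiency.

(** * Necessity: a positive supersolution forces both conditions *)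

Section necessity.
Context (u : T -> R) (A : R).
Hypothesis u0 : forall x, 0 < u x.
Hypothesis mu : measurable_fun [set: T] u.
Hypothesis A0 : 0 < A.
Hypothesis supersolution : forall x,
  (\int[sigma]_y (riesz gamma (d x y) * (u y `^ q)%:E) <= (A * u x)%:E)%E.

Let w (y : T) := (u y `^ q)%:E.

Let w0 y : (0 <= w y)%E. Proof. by rewrite lee_fin powR_ge0. Qed.

Let mw : measurable_fun [set: T] w.
Proof.
by apply/measurable_EFinP; exact: (measurableT_comp (measurable_powR q) mu).
Qed.

(** The later lower bounds for [u] all come from here: on a region [D] the kernel is at least [c]
    times a function [h], which is either 1 or again a kernel. *)
Let supersolution_ge (x : T) (D : set T) (c : R) (h : T -> \bar R) :
  measurable D -> 0 <= c -> (forall y, (0 <= h y)%E) ->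
  measurable_fun [set: T] h ->
  (forall y, D y -> (c%:E * h y <= riesz gamma (d x y))%E) ->
  (c%:E * \int[sigma]_(y in D) (h y * w y) <= (A * u x)%:E)%E.
Proof.
move=> mD c0 h0 mh hD; apply: le_trans (supersolution x).
rewrite -ge0_integralZl//; last 2 first.
- by apply: measurable_funTS; exact: emeasurable_funM.
- by move=> y _; rewrite mule_ge0.
apply: ge0_subset_le_integral => //.
- by move=> y _; rewrite !mule_ge0// lee_fin.
- by move=> y _; rewrite mule_ge0 ?riesz_ge0// lee_fin powR_ge0.
- by move=> y Dy; rewrite muleA; apply: lee_wpmul2r => //; exact: hD.
Qed.

(** As [u] is positive, the sets [S n], on which [d o] is bounded and [u] is bounded away from 0,
    exhaust the space, so one of them has positive measure. The integral over it may be infinite,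
    hence a real [a] below it. *)
Let mass_lower (o : T) : (sigma [set: T] != 0)%E ->
  exists (r0 a : R) (D : set T), [/\ 0 < r0, 0 < a, measurable D,
    forall y, D y -> d o y < r0 & (a%:E <= \int[sigma]_(y in D) w y)%E].
Proof.
move=> sT.
pose S (n : nat) := [set y | d o y < n.+1%:R] `&` [set y | n.+1%:R^-1 < u y].
have mS n : measurable (S n).
  apply: measurableI; first exact: measurable_ball.
  have -> : [set y | n.+1%:R^-1 < u y] = setT `&` u @^-1` `]n.+1%:R^-1, +oo[.
    by rewrite setTI; apply/seteqP; split=> y /=; rewrite in_itv /= andbT.
  exact: mu.
have [n Sn] : exists n, (sigma (S n) != 0)%E.
  apply: contrapT => h.
  have Sn0 n : sigma.-negligible (S n).
    apply/negligibleP => //; apply: contrapT => /eqP Sn.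
    by apply: h; exists n.
  have : sigma.-negligible [set: T].
    have -> : [set: T] = \bigcup_n S n.
      apply/seteqP; split=> // y _.
      have [N _ hN] := @nbhs_infty_gtr R (Num.max (d o y) (u y)^-1).
      have := hN N.+1 (leqnSn N); rewrite gt_max => /andP[h1 h2].
      exists N => //; split => //=.
      by rewrite -[ltRHS]invrK ltf_pV2 ?posrE ?invr_gt0.
    exact: negligible_bigcup.
  by move/negligibleP => sT0; move: sT; rewrite sT0// eqxx.
pose e : R := n.+1%:R^-1 `^ q.
have e0 : 0 < e by rewrite powR_gt0// invr_gt0.
have lb : (e%:E * sigma (S n) <= \int[sigma]_(y in S n) w y)%E.
  rewrite -(integral_cst sigma (mS n)).
  apply: ge0_le_integral_nonmeasurable => y Sy.
    by rewrite lee_fin ltW.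
  rewrite /w lee_fin; apply: ge0_ler_powR;
    rewrite ?nnegrE ?(ltW (u0 _)) ?(ltW q0) ?invr_ge0//.
  by case: Sy => _ /ltW.
have pos : (0 < \int[sigma]_(y in S n) w y)%E.
  apply: lt_le_trans lb; rewrite mule_gt0 ?lte_fin// lt0e Sn /=.
  exact: measure_ge0.
have [a a0 aw] : exists2 a : R, 0 < a & (a%:E <= \int[sigma]_(y in S n) w y)%E.
  move: pos; case: (\int[sigma]_(y in S n) w y)%E => [r r0| _ |//].
    by exists r.
  by exists 1 => //; rewrite leey.
by exists n.+1%:R, a, (S n); split => // y [].
Qed.

(** Raised to the power [q], a lower bound for [u] becomes a bound of 1 by a multiple of the
    integrand in [integral_powR_cumulative]. *)
Let powR_tradeoff (c s v : R) : 0 < c -> 0 < s -> c * s <= v ->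
  1 <= c `^ (- q) * (s `^ (- q) * v `^ q).
Proof.
move=> c0 s0 csv; rewrite mulrA -powRM ?(ltW c0) ?(ltW s0)// powRN.
have cs0 : 0 < c * s by rewrite mulr_gt0.
rewrite mulrC ler_pdivlMr ?powR_gt0// mul1r.
by apply: ge0_ler_powR => //; rewrite ?nnegrE ?ltW// (lt_le_trans cs0).
Qed.

Section nonzero.
Context (o : T) (r0 a : R) (D : set T).
Hypothesis r00 : 0 < r0.
Hypothesis a0 : 0 < a.
Hypothesis mD : measurable D.
Hypothesis Dr0 : forall y, D y -> d o y < r0.
Hypothesis aw : (a%:E <= \int[sigma]_(y in D) w y)%E.

Let X (y : T) := r0 + d o y.

Let X0 y : 0 < X y. Proof. by rewrite ltr_wpDr. Qed.

(** All of [D] lies within [X x] of [x], so the kernel is at least r^(-gamma) there. *)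
Let lower_bound (x : T) (r : R) : X x <= r -> a * r `^ (- gamma) <= A * u x.
Proof.
move=> Xr; rewrite -lee_fin mulrC EFinM.
have := @supersolution_ge x D (r `^ (- gamma)) (cst 1%E) mD (powR_ge0 _ _).
have r0' : 0 < r := lt_le_trans (X0 x) Xr.
under [in X in (_ -> _ -> _ -> X) -> _]eq_integral do rewrite mul1e.
move=> h; apply: le_trans (h _ _ _) => //.
  by apply: lee_wpmul2l => //; rewrite lee_fin powR_ge0.
move=> y Dy; rewrite mule1 -rieszE//; apply: le_riesz => //; first exact: ltW.
apply: le_trans Xr; apply: le_trans (d_triangle x o y) _.
by rewrite (d_sym x o) addrC /X lerD2r ltW// Dr0.
Qed.

Let F (y : T) := (\int[sigma]_(z in [set z | (d o z <= d o y)%R]) w z)%E.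

Let F0 y : (0 <= F y)%E. Proof. exact: integral_ge0. Qed.

(** On the region of integration d x y <= 2 d o x <= 2 X x. *)
Let F_le (x : T) : (((2 * X x) `^ (- gamma))%:E * F x <= (A * u x)%:E)%E.
Proof.
have mDx : measurable [set z | d o z <= d o x] by exact: measurable_sublevel.
have := @supersolution_ge x [set z | d o z <= d o x]
  ((2 * X x) `^ (- gamma)) (cst 1%E) mDx (powR_ge0 _ _).
under [in X in (_ -> _ -> _ -> X) -> _]eq_integral do rewrite mul1e.
apply=> // y /= yx; rewrite mule1 -rieszE ?mulr_gt0//.
apply: le_riesz => //; first exact: ltW.
apply: le_trans (d_triangle x o y) _; rewrite (d_sym x o) /X.
have := r00; lra.
Qed.

Let Ffin y : (F y < +oo)%E.
Proof.
rewrite ltey; apply/eqP => Fy; have := F_le y.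
by rewrite Fy gt0_muley ?leye_eq// lte_fin powR_gt0// mulr_gt0.
Qed.

(** Constant for bounding [u] below by a sum of two terms: adding two separate bounds for [A * u]
    gives [2 * A], and 2^(-gamma) comes from a doubled distance. *)
Let c := 2 `^ (- gamma) / (2 * A).

Let c0 : 0 < c. Proof. by rewrite divr_gt0 ?mulr_gt0 ?powR_gt0. Qed.

Let cq := c `^ (- q).

Let cq0 : 0 < cq. Proof. exact: powR_gt0. Qed.

Let Cq := 2 / (1 - 2 `^ (1 - q)) : R.

Let lower_cumulative (y : T) :
  X y `^ (- (gamma * q)) <= cq * ((a + fine (F y)) `^ (- q) * u y `^ q).
Proof.
have aF : 0 < a + fine (F y) by rewrite ltr_wpDr ?fine_ge0.
have h1 : a * (2 * X y) `^ (- gamma) <= A * u y.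
  by apply: lower_bound; rewrite ler_peMl ?(ltW (X0 y))// ler1n.
have h2 : (2 * X y) `^ (- gamma) * fine (F y) <= A * u y.
  by have := F_le y; rewrite -[F y]fineK ?ge0_fin_numE// -EFinM lee_fin.
have h3 : c * (X y `^ (- gamma) * (a + fine (F y))) <= u y.
  rewrite /c mulrAC ler_pdivrMr ?mulr_gt0//.
  move: h1 h2; rewrite powRM ?(ltW (X0 y))// => h1 h2; lra.
have Xg : 0 < X y `^ (- gamma) by exact: powR_gt0.
have := @powR_tradeoff c _ _ c0 (mulr_gt0 Xg aF) h3.
rewrite -/cq [(X y `^ _ * _) `^ _]powRM ?powR_ge0 ?(ltW aF)//.
rewrite -powRrM mulrNN => h.
have Xp : 0 < X y `^ (- (gamma * q)) by exact: powR_gt0.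
rewrite -[leLHS]mulr1; apply: le_trans (ler_wpM2l (ltW Xp) h) _.
rewrite le_eqVlt; apply/orP; left; apply/eqP.
have XX : X y `^ (- (gamma * q)) * X y `^ (gamma * q) = 1.
  by rewrite powRN mulVf// gt_eqF// powR_gt0.
rewrite -[RHS]mul1r -{1}XX; ring.
Qed.

Let tail_integral :
  (\int[sigma]_y (X y `^ (- (gamma * q)))%:E < +oo)%E.
Proof.
have core := integral_powR_cumulative mw w0 (md o) Ffin a0 q1.
apply: le_lt_trans (_ : (_ <= cq%:E * (Cq * a `^ (1 - q))%:E)%E) _; last first.
  by rewrite -EFinM ltey.
apply: le_trans; last by apply: (lee_wpmul2l _ core); rewrite lee_fin ltW.
rewrite -ge0_integralZl//; first last.
- by rewrite lee_fin ltW.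
- by move=> y _; rewrite mule_ge0// lee_fin powR_ge0.
- apply: emeasurable_funM => //; apply/measurable_EFinP.
  apply: (measurableT_comp (measurable_powR (- q))).
  apply: measurable_funD => //.
  exact: (measurable_cumulative mw w0 (md o) Ffin).
apply: ge0_le_integral_nonmeasurable => y _; first by rewrite lee_fin powR_ge0.
by rewrite /w -!EFinM lee_fin; exact: lower_cumulative.
Qed.

(** On the ball the weight is at least (r0 + t)^(-gamma q), and it is integrable by
    [tail_integral]. *)
Let finite_ball (t : R) : (sigma (metric_ball d o t) < +oo)%E.
Proof.
have [t0|t0] := leP t 0.
  have -> : metric_ball d o t = set0.
    apply/seteqP; split=> // y; rewrite /metric_ball /= => yt.
    by have := le_lt_trans (d_ge0 o y) (lt_le_trans yt t0); rewrite ltxx.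
  by rewrite measure0.
have rt : 0 < r0 + t by rewrite addr_gt0.
have p0 : 0 < (r0 + t) `^ (- (gamma * q)) by exact: powR_gt0.
have : (((r0 + t) `^ (- (gamma * q)))%:E * sigma (metric_ball d o t) <=
    \int[sigma]_y (X y `^ (- (gamma * q)))%:E)%E.
  rewrite -(integral_cst sigma (measurable_ball o t)).
  apply: ge0_subset_le_integral => //.
  - by move=> y _; rewrite lee_fin powR_ge0.
  - by move=> y _; rewrite lee_fin powR_ge0.
  - move=> y /= ty; rewrite lee_fin; apply: ler_powRN => //; first exact: ltW.
    by rewrite /X lerD2l ltW.
move=> /le_lt_trans/(_ tail_integral) h.
rewrite ltey; apply: contraTneq h => ->.
by rewrite gt0_muley ?ltxx// lte_fin.
Qed.

Lemma supersolution_tail : tail_condition o r0.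
Proof.
rewrite /tail_condition.
have fin := finite_balls_center o finite_ball.
apply: le_lt_trans (integral_tail_le gq0 (md o) (d_ge0 o) fin r00) _.
rewrite lte_mul_pinfty// ?lee_fin ?mulr_ge0 ?powR_ge0 ?invr_ge0 ?(ltW gq0)//.
Qed.

(** * The local condition at one centre *)

Section local_estimate.
Context (x : T) (r : R).
Hypothesis rr0 : r0 < r.
Hypothesis xr : d o x < r.

Let r_gt0 : 0 < r. Proof. exact: lt_trans r00 rr0. Qed.

Let f (y : T) := (riesz gamma (d x y) * w y)%E.

Let f0 y : (0 <= f y)%E. Proof. by rewrite mule_ge0 ?riesz_ge0. Qed.

Let mf : measurable_fun [set: T] f. Proof. exact: emeasurable_funM. Qed.

(** The sign turns the regions d x z >= d x y, which exclude a ball around [x], into sublevel sets,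
    so that [integral_powR_cumulative] applies to [H]. *)
Let g (y : T) := - d x y.

Let mg : measurable_fun [set: T] g. Proof. exact: measurableT_comp. Qed.

Let H (y : T) := (\int[sigma]_(z in [set z | (g z <= g y)%R]) f z)%E.

Let H0 y : (0 <= H y)%E. Proof. exact: integral_ge0. Qed.

Let Hfin y : (H y < +oo)%E.
Proof.
apply: (@le_lt_trans _ _ (A * u x)%:E); last by rewrite ltey.
apply: le_trans (supersolution x); apply: ge0_subset_integral => //.
exact: measurable_sublevel.
Qed.

(** If d x z >= d x y then d y z <= 2 d x z, and doubling the distance multiplies the kernel by
    2^(-gamma). *)
Let H_le (y : T) : ((2 `^ (- gamma))%:E * H y <= (A * u y)%:E)%E.
Proof.
apply: supersolution_ge => //.
- exact: measurable_sublevel.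
- by move=> z; exact: riesz_ge0.
- move=> z /=; rewrite /g lerN2 => yz; rewrite -riesz_double//.
  apply: le_riesz => //; first exact: ltW.
  apply: le_trans (d_triangle y x z) _; rewrite (d_sym y x).
  by rewrite -[2]/(1 + 1) mulrDl mul1r lerD2r.
Qed.

(** The radius is [3 * r] because r0 + d o y <= r0 + d o x + d x y < 3 r on the ball; 2^gamma
    cancels the factor 2^(-gamma) of [c]. *)
Let alpha := 2 `^ gamma * (a * (3 * r) `^ (- gamma)).

Let alpha0 : 0 < alpha. Proof. by rewrite !mulr_gt0 ?powR_gt0 ?mulr_gt0. Qed.

Let local_lower (y : T) : d x y < r -> c * (alpha + fine (H y)) <= u y.
Proof.
move=> yr.
have h1 : a * (3 * r) `^ (- gamma) <= A * u y.
  apply: lower_bound; rewrite /X.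
  have := d_triangle o x y; move: yr xr rr0 => ? ? ? ?; lra.
have h2 : 2 `^ (- gamma) * fine (H y) <= A * u y.
  by have := H_le y; rewrite -[H y]fineK ?ge0_fin_numE// -EFinM lee_fin.
have h3 : 2 `^ (- gamma) * alpha = a * (3 * r) `^ (- gamma).
  by rewrite /alpha mulrA powRN mulVf ?mul1r// gt_eqF// powR_gt0.
rewrite /c mulrAC ler_pdivrMr ?mulr_gt0// mulrDr h3; lra.
Qed.

(** On the ball [powR_tradeoff] inserts (alpha + H)^(-q) u^q next to the kernel. The kernel times
    u^q is [f], whose cumulative integral is [H], so [integral_powR_cumulative] bounds the
    result. *)
Lemma local_riesz_le :
  (\int[sigma]_(y in metric_ball d x r) riesz gamma (d x y) <=
   (cq * (Cq * alpha `^ (1 - q)))%:E)%E.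
Proof.
have core := integral_powR_cumulative mf f0 mg Hfin alpha0 q1.
rewrite EFinM.
apply: le_trans; last by apply: (lee_wpmul2l _ core); rewrite lee_fin ltW.
rewrite -ge0_integralZl//; first last.
- by rewrite lee_fin ltW.
- by move=> y _; rewrite mule_ge0// lee_fin powR_ge0.
- apply: emeasurable_funM => //; apply/measurable_EFinP.
  apply: (measurableT_comp (measurable_powR (- q))).
  apply: measurable_funD => //.
  exact: (measurable_cumulative mf f0 mg Hfin).
have k0 y : (0 <= cq%:E * (((alpha + fine (H y)) `^ (- q))%:E * f y))%E.
  by rewrite !mule_ge0 ?riesz_ge0 ?lee_fin ?powR_ge0//; exact: ltW.
apply: ge0_subset_le_integral => // y.
- by move=> _; exact: riesz_ge0.
- by move=> _; exact: k0.
move=> /= yr; rewrite /f (muleC (riesz _ _)) 2!muleA /w -!EFinM.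
rewrite -[leLHS]mul1e; apply: lee_wpmul2r; first exact: riesz_ge0.
rewrite lee_fin -mulrA; apply: powR_tradeoff => //; last exact: local_lower.
by rewrite ltr_wpDr// fine_ge0//; exact: H0.
Qed.

End local_estimate.

Lemma supersolution_local : exists2 C : R, 0 < C & local_condition o r0 C.
Proof.
(* [alpha] is [B] times r^(-gamma), and the exponent 1 - q turns this power into r^(gamma (q -
   1)). *)
pose B := 2 `^ gamma * (a * 3 `^ (- gamma)).
have B0 : 0 < B by rewrite !mulr_gt0 ?powR_gt0.
have Cq0 : 0 < Cq.
  by rewrite divr_gt0// subr_gt0; exact: powR_lt1_gt1.
exists (gamma^-1 * (cq * (Cq * B `^ (1 - q)))).
  by rewrite mulr_gt0 ?invr_gt0// mulr_gt0// mulr_gt0// powR_gt0.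
move=> r rr0; have r_gt0 : 0 < r := lt_trans r00 rr0.
apply: ge_ereal_sup => _ [x /= xr <-].
have fin := finite_balls_center x finite_ball.
apply: le_trans (integral_local_le gamma0 (md x) (d_ge0 x) fin r) _.
have gi : (0 <= (gamma^-1)%:E)%E by rewrite lee_fin invr_ge0 ltW.
apply: le_trans (lee_wpmul2l gi (local_riesz_le rr0 xr)) _.
have -> : 2 `^ gamma * (a * (3 * r) `^ (- gamma)) = B * r `^ (- gamma).
  by rewrite powRM ?(ltW r_gt0)// /B !mulrA.
have -> : (B * r `^ (- gamma)) `^ (1 - q) =
    B `^ (1 - q) * r `^ (gamma * (q - 1)).
  rewrite powRM ?powR_ge0 ?(ltW B0)// -powRrM.
  by have -> : - gamma * (1 - q) = gamma * (q - 1) by ring.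
by rewrite -EFinM lee_fin !mulrA.
Qed.

End nonzero.

Lemma supersolution_conditions (o : T) : exists r0 C : R,
  [/\ 0 < r0, 0 < C, tail_condition o r0 & local_condition o r0 C].
Proof.
have [s0|/(mass_lower o)[r0 [a [D [r00 a0 mD Dr0 aw]]]]] :=
    eqVneq (sigma [set: T]) 0%E.
  (* The zero measure has no positive mass [a] to start from; both conditions then hold trivially
     with constants 1. *)
  have sB x r : sigma (metric_ball d x r) = 0%E.
    apply/eqP; rewrite -measure_le0 -s0; apply: le_measure; rewrite ?inE//.
  exists 1, 1; split => //.
    rewrite /tail_condition; under eq_integral do rewrite sB mul0e.
    by rewrite integral0.
  move=> r r1; apply: ge_ereal_sup => _ [x _ <-].
  under eq_integral do rewrite sB mul0e.
  by rewrite integral0 lee_fin mulr_ge0 ?powR_ge0.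
have [C C0 HC] := supersolution_local r00 a0 mD Dr0 aw.
by exists r0, C; split => //; exact: supersolution_tail Dr0 aw.
Qed.

End necessity.
End metric_measure.

(** * Comparison with the Green function *)

Lemma measurable_lower_semicontinuous (R : realType) (M : ptopologicalType)
    (u : M -> R) : lower_semicontinuous (fun x => (u x)%:E) ->
  measurable_fun [set: borel M] (u : borel M -> R).
Proof.
move/lower_semicontinuousP => lsc.
apply: (measurability _ (RGenOInfty.measurableE R)) => //.
move=> _ [_ [t ->] <-]; rewrite setTI; apply: sub_sigma_algebra.
have -> : u @^-1` `]t, +oo[ = [set x | (t%:E < (u x)%:E)%E].
  by apply/seteqP; split=> x /=; rewrite in_itv /= andbT lte_fin.
exact: lsc.
Qed.

Lemma continuous_lower_semicontinuous (R : realType) (M : topologicalType)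
    (u : M -> R) : continuous u -> lower_semicontinuous (fun x => (u x)%:E).
Proof.
move=> cu; apply/lower_semicontinuousP => t.
have -> : [set x | (t%:E < (u x)%:E)%E] = u @^-1` [set s | t < s].
  by apply/seteqP; split=> x /=; rewrite lte_fin.
by apply: open_comp => [x _|]; [exact: cu|exact: open_gt].
Qed.

Lemma metric_continuous (R : realType) (M : topologicalType) (d : M -> M -> R) :
  is_metric d -> (forall x e, 0 < e -> \forall y \near x, d x y < e) ->
  forall x, continuous (d x).
Proof.
move=> [_ _ dsym dtri] dnear x y; apply/cvgrPdist_lt => e e0.
near=> z; have yz : d y z < e by near: z; exact: dnear.
have h1 := dtri x y z; have h2 := dtri x z y; rewrite (dsym z y) in h2.
by rewrite ltr_norml; apply/andP; split; lra.
Unshelve. all: by end_near. Qed.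

Section green_kernel.
Context (R : realType) (M : topologicalType) (G : M -> M -> \bar R)
  (d : M -> M -> R) (gamma c1 c2 : R).
Hypothesis d_metric : is_metric d.
Hypothesis gamma0 : 0 < gamma.
Hypothesis c10 : 0 < c1.
Hypothesis c20 : 0 < c2.
Hypothesis Gd : forall x y, x <> y ->
  ((c1 * d x y `^ (- gamma))%:E <= G x y)%E /\
  (G x y <= (c2 * d x y `^ (- gamma))%:E)%E.
Hypothesis Gpole : forall x, G x x = +oo%E.

Let d_ge0 x y : 0 <= d x y. Proof. by have [h _ _ _] := d_metric. Qed.

Let d_eq0 x y : d x y = 0 <-> x = y.
Proof. by have [_ h _ _] := d_metric; exact: h. Qed.

Let d_refl x : d x x = 0. Proof. exact/d_eq0. Qed.

Let d_gt0 x y : x <> y -> 0 < d x y.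
Proof.
by move=> xy; rewrite lt_neqAle d_ge0 andbT eq_sym; apply/eqP => /d_eq0.
Qed.

Lemma riesz_le_green x y : (c1%:E * riesz gamma (d x y) <= G x y)%E.
Proof.
have [<-|xy] := pselect (x = y); first by rewrite Gpole leey.
by rewrite rieszE ?d_gt0// -EFinM; have [] := Gd xy.
Qed.

Lemma green_le_riesz x y : (G x y <= c2%:E * riesz gamma (d x y))%E.
Proof.
have [<-|xy] := pselect (x = y).
  by rewrite d_refl /riesz eqxx gt0_muley ?leey.
by rewrite rieszE ?d_gt0// -EFinM; have [] := Gd xy.
Qed.

(** A point [y] with G x y > c2 e^(-gamma) satisfies d x y < e, and such points form a neighbourhood
    of [x] because [G x] tends to +oo at its pole. This ties [d] to the topology of [M]. *)
Lemma green_metric_continuous :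
  (forall x, {for x, continuous (G x)}) -> forall x, continuous (d x).
Proof.
move=> Gcont; apply: metric_continuous => // x e e0.
have : G x y @[y --> x] --> +oo%E by rewrite -(Gpole x); exact: Gcont.
move=> /cvgeyPgt/(_ (c2 * e `^ (- gamma))).
apply: filterS => y Gxy.
have [<-|xy] := pselect (x = y); first by rewrite d_refl.
rewrite ltNge; apply/negP => ed.
have [_ /(lt_le_trans Gxy)] := Gd xy.
rewrite lte_fin ltr_pM2l// ltNge => /negP; apply.
by apply: ler_powRN => //; exact: ltW.
Qed.

End green_kernel.

Theorem theorem1p4 (R : realType) (n : nat) (M : ptopologicalType)
    (S : riemannian_manifold R n M)
    (M_connected : connected [set: M])
    (M_complete : complete_manifold S)
    (M_noncompact : ~ compact [set: M])
    (mu : {measure set (borel M) -> \bar R})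
    (mu_riemannian : is_riemannian_measure S mu)
    (M_nonparabolic : nonparabolic S mu)
    (G : M -> M -> \bar R)
    (G_green : is_minimal_green S mu G)
    (q : R) (q_gt1 : 1 < q)
    (sigma : {measure set (borel M) -> \bar R})
    (sigma_radon : is_radon sigma)
    (d : M -> M -> R) (d_metric : is_metric d)
    (gamma : R) (gamma_gt0 : 0 < gamma)
    (G_approx : comparable_to_power G d gamma) :
  (exists u : M -> R, is_positive_solution G q sigma u) <->
  (exists (o : M) (r0 C : R),
    [/\ 0 < r0, 0 < C,
      (\int[@lebesgue_measure R]_(t in `[r0, +oo[)
         (sigma (metric_ball d o t) * ((t `^ (gamma * q + 1))^-1)%:E) < +oo)%E
    & forall r : R, r0 < r ->
      (ereal_sup [set \int[@lebesgue_measure R]_(s in `]0%R, r])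
                    (sigma (metric_ball d x s) *
                     ((s `^ (gamma + 1))^-1)%:E)
                 | x in metric_ball d o r]
       <= (C * r `^ (gamma * (q - 1)))%:E)%E]).
Proof.
have [c1 [c2 [c10 c20 Gd]]] := G_approx.
have [Ggreen _ _] := G_green.
have Gpole x : G x x = +oo%E := green_pole (Ggreen x).
have Ggt0 x y : (0 < G x y)%E := green_gt0 (Ggreen x) y.
have cd : forall x, continuous (d x).
  apply: (green_metric_continuous d_metric gamma_gt0 c20 Gd Gpole) => x.
  exact: green_cvg_pole (Ggreen x).
have md x : measurable_fun [set: borel M] (d x : borel M -> R).
  apply: measurable_lower_semicontinuous.
  by apply: continuous_lower_semicontinuous; exact: cd.
have d_ge0 x y : 0 <= d x y by have [h _ _ _] := d_metric.
have mK x :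
    measurable_fun [set: borel M] (fun y : borel M => riesz gamma (d x y)).
  exact: (measurableT_comp (measurable_riesz gamma) (md x)).
split=> [[u [u0 ulsc usol]]|[ o [r0 [C [r00 C0 tail local]]]]].
  have mu_ := measurable_lower_semicontinuous ulsc.
  have mw : measurable_fun [set: borel M] (fun y : borel M => (u y `^ q)%:E).
    apply/measurable_EFinP.
    exact: (measurableT_comp (measurable_powR q) mu_).
  have super x : (\int[sigma]_y (riesz gamma (d x y) * (u y `^ q)%:E) <=
      (c1^-1 * u x)%:E)%E.
    rewrite EFinM lee_pdivlMl//; apply: le_trans (usol x).
    rewrite -ge0_integralZl//; first last.
    - by rewrite lee_fin ltW.
    - by move=> y _; rewrite mule_ge0 ?riesz_ge0// lee_fin powR_ge0.
    - exact: emeasurable_funM.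
    apply: ge0_le_integral_nonmeasurable => y _.
      by rewrite !mule_ge0 ?riesz_ge0 ?lee_fin ?powR_ge0 ?(ltW c10).
    rewrite muleA; apply: lee_wpmul2r; first by rewrite lee_fin powR_ge0.
    exact: (riesz_le_green d_metric Gd Gpole).
  have c1V : 0 < c1^-1 by rewrite invr_gt0.
  (* The centre is arbitrary, so the default point of [M] serves. *)
  have [r0 [C [r00 C0 tail local]]] :=
    @supersolution_conditions _ (borel M) R sigma d gamma q d_metric md
      gamma_gt0 q_gt1 u c1^-1 u0 mu_ c1V super point.
  by exists point, r0, C.
have [B B0 HB] :=
  @riesz_potential_le _ (borel M) R sigma d gamma q d_metric md gamma_gt0 q_gt1
    o r0 C r00 C0 tail local.
have q0 : 0 < q := lt_trans ltr01 q_gt1.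
(* Chosen so that c2 B e^q = e: the potential estimate then returns exactly [u]. *)
pose e := (c2 * B) `^ (- (q - 1)^-1).
have cB0 : 0 < c2 * B by rewrite mulr_gt0.
have e0 : 0 < e by exact: powR_gt0.
have eq1 : e `^ q = e * (c2 * B)^-1.
  have -> : e `^ q = e * e `^ (q - 1) by rewrite mulr_powRB1// ltW.
  congr (_ * _); rewrite /e -powRrM mulNr mulVf ?powR_inv1 ?(ltW cB0)//.
  by rewrite gt_eqF// subr_gt0.
have p0 y : 0 < r0 + d o y by rewrite ltr_wpDr.
pose u y := e * (r0 + d o y) `^ (- gamma).
exists u; split.
- by move=> x; rewrite mulr_gt0// powR_gt0.
- apply: continuous_lower_semicontinuous => x.
  apply: cvgMl_tmp.
  have cp : {for r0 + d o x, continuous (fun s : R => s `^ (- gamma))}.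
    apply/differentiable_continuous; apply/derivable1_diffP.
    exact: (@ex_derive _ _ _ _ _ _ _ (is_derive1_powR _ (p0 x))).
  apply: (@continuous_comp _ _ _
    (fun y => r0 + d o y) (fun s : R => s `^ (- gamma))) => //.
  by apply: cvgD; [exact: cvg_cst|exact: cd].
- move=> x.
  pose v y := (r0 + d o y) `^ (- (gamma * q)).
  have uq y : u y `^ q = e `^ q * v y.
    by rewrite /u powRM ?powR_ge0 ?(ltW e0)// -powRrM mulNr.
  have mv : measurable_fun [set: borel M] (fun y : borel M => (v y)%:E).
    apply/measurable_EFinP.
    apply: (measurableT_comp (measurable_powR (- (gamma * q)))).
    exact: measurable_funD.
  apply: (@le_trans _ _ (\int[sigma]_y
    ((c2 * e `^ q)%:E * (riesz gamma (d x y) * (v y)%:E)))%E).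
    apply: ge0_le_integral_nonmeasurable => y _.
      by rewrite mule_ge0 ?(ltW (Ggt0 _ _))// lee_fin powR_ge0.
    rewrite uq !EFinM [leRHS]muleACA; apply: lee_wpmul2r.
      by rewrite -EFinM lee_fin mulr_ge0 ?powR_ge0.
    exact: (green_le_riesz d_metric c20 Gd).
  rewrite ge0_integralZl//; first last.
  + by rewrite lee_fin mulr_ge0 ?powR_ge0 ?(ltW c20).
  + by move=> y _; rewrite mule_ge0 ?riesz_ge0// lee_fin powR_ge0.
  + exact: emeasurable_funM.
  apply: le_trans; first apply: (lee_wpmul2l _ (HB x)).
    by rewrite lee_fin mulr_ge0 ?powR_ge0 ?(ltW c20).
  rewrite -EFinM lee_fin eq1 /u le_eqVlt; apply/orP; left; apply/eqP.
  have cBV : c2 * B * (c2 * B)^-1 = 1 by rewrite mulfV// gt_eqF.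
  rewrite -[RHS]mul1r -cBV; ring.
Qed.
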